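(* Fix $d\ge1$. For every partition $\lambda$ of $n$ with $\ell(\lambda)\le d$ (set $\lambda_i=0$ for $i>\ell(\lambda)$), as an identity of rational functions in $\beta$ and $q$, $$\sum_{T\in\operatorname{SIT}(\lambda)}\prod_{k=1}^{m(T)}\left(\left[\prod_{i=1}^d\frac{1+\beta q^{\nu_i(T_{<k})+d-i+1}}{1+\beta q^{\lambda_i+d-i+1}}\right]-1\right)^{-1}=\frac{q^{-\sum_{(i,j)\in\lambda}(d+j-\lambda'_j)}}{\beta^n}\prod_{i=1}^d\big(1+\beta q^{\lambda_i+d-i+1}\big)^{\lambda_i}\prod_{(i,j)\in\lambda}\frac{1}{1-q^{h(i,j)}}.$$
   Context: Partitions are identified with Young diagrams $\{(i,j):1\le j\le\lambda_i\}$ (English convention); $\lambda'$ is the conjugate and $h(i,j)=\lambda_i-j+\lambda'_j-i+1$ the hook length. A standard increasing tableau of shape $\lambda$ is a filling $T$ of the cells of $\lambda$ by positive integers, strictly increasing along rows and down columns, whose set of entries is $\{1,\dots,m\}$ for some $m=m(T)$; $\operatorname{SIT}(\lambda)$ is their set. $\nu(T_{<k})$ is the partition formed by the cells with entry $<k$, with parts $\nu_i(T_{<k})$. *)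

(* Defs.v *)
From HB Require Import structures.
From mathcomp Require Import all_boot all_order all_algebra fraction.
Set Implicit Arguments. Unset Strict Implicit. Unset Printing Implicit Defensive.
Import Order.TTheory GRing.Theory Num.Theory.

Definition is_partition (lam : seq nat) : bool :=
  sorted geq lam && all (fun x => 0 < x) lam.

Definition part (lam : seq nat) (i : nat) : nat := nth 0 lam i.

(* conjugate part lambda'_j (1-indexed j) = #{ i | lambda_i >= j } *)
Definition conj_part (lam : seq nat) (j : nat) : nat := count (fun x => j <= x) lam.

Definition in_shape (lam : seq nat) (i j : nat) : bool := j < part lam i.

(* hook length of the 0-indexed cell (i,j), i.e. of the 1-indexed cell (i+1,j+1):
   lambda_{i+1} - (j+1) + lambda'_{j+1} - (i+1) + 1 *)
Definition hook (lam : seq nat) (i j : nat) : nat :=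
  (part lam i - j.+1) + (conj_part lam j.+1 - i.+1) + 1.

(* Fillings: cells (i,j) with i < d, j < n (enough to contain a shape of size n
   with at most d rows); entries in {0..n}; value 0 encodes "no cell". *)
Definition tableau (d n : nat) := {ffun 'I_d * 'I_n -> 'I_n.+1}.

Definition tv d n (T : tableau d n) (i : 'I_d) (j : 'I_n) : nat := T (i, j).

Definition mT d n (T : tableau d n) : nat := \max_(c : 'I_d * 'I_n) (T c : nat).

Definition is_SIT d n (lam : seq nat) (T : tableau d n) : bool :=
  [&& [forall i : 'I_d, forall j : 'I_n, in_shape lam i j == (0 < tv T i j)],
      [forall i : 'I_d, forall j1 : 'I_n, forall j2 : 'I_n,
         ((j1 < j2) && in_shape lam i j2) ==> (tv T i j1 < tv T i j2)],
      [forall i1 : 'I_d, forall i2 : 'I_d, forall j : 'I_n,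
         ((i1 < i2) && in_shape lam i2 j) ==> (tv T i1 j < tv T i2 j)] &
      [forall k : 'I_n.+1, ((0 < k) && (k <= mT T)) ==>
         [exists c : 'I_d * 'I_n, (T c : nat) == k]]].

Definition nu d n (lam : seq nat) (T : tableau d n) (k : nat) (i : 'I_d) : nat :=
  #|[set j : 'I_n | in_shape lam i j && (tv T i j < k)]|.

Definition Kf := {fraction {poly {poly rat}}}.
Definition qv : Kf := @FracField.tofrac _ (('X : {poly rat})%:P).
Definition betav : Kf := @FracField.tofrac _ ('X : {poly {poly rat}}).

Definition qexp (d : nat) (lam : seq nat) : int :=
  (\sum_(i < size lam) \sum_(j < part lam i)
     ((d + j.+1)%:Z - (conj_part lam j.+1)%:Z))%R.

(* Main.v *)
Require Import Defs.
From HB Require Import structures.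
From mathcomp Require Import all_boot all_order all_algebra fraction.
From mathcomp Require Import perm zify ring.
Import Order.TTheory GRing.Theory Num.Theory.
Set Implicit Arguments. Unset Strict Implicit. Unset Printing Implicit Defensive.
Local Open Scope ring_scope.

(** Put [B l = 1 + beta q^l] and let [D_mu(x)] be the determinant of the
    [prod_(1 <= l <= mu_j + d - j) (B_l x_i - 1) x_i^(j - 1)], the numerator of
    the factorial Grothendieck polynomial.  It satisfies a Pieri rule:
    [prod_i x_i B_(mu_i + d - i + 1) D_mu] is the sum of the [D_nu] over all
    [nu] obtained from [mu] by adding a set of addable corners.  At the point
    [x_i = 1 / B_(lam_i + d - i + 1)] the [D_nu] with [nu] not inside [lam]
    vanish, so the Pieri rule becomes the recursion satisfied by the weighted
    sums over the increasing tableaux of shape [lam / mu], obtained by removing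
    the entries equal to 1.  Hence the sum for [mu] empty is [D_0 / D_lam].
    There [D_0] is a Vandermonde determinant and [D_lam] is triangular, and the
    hook lengths arise by cancelling factors row by row. *)

(** * Determinants *)

(** Multilinearity in all rows at once: in the Leibniz formula each product of sums distributes over
    the set [S] of rows where [F] is chosen. *)
Lemma det_rowD (R : comNzRingType) (n : nat) (F G : 'I_n -> 'I_n -> R) :
  \det (\matrix_(j, i) (F j i + G j i)) =
  \sum_(S : {set 'I_n}) \det (\matrix_(j, i) (if j \in S then F j i else G j i)).
Proof.
rewrite /determinant exchange_big /=; apply: eq_bigr => s _.
rewrite -mulr_sumr; congr (_ * _).
under eq_bigr do rewrite mxE.
rewrite bigA_distr; apply: eq_bigr => S _; apply: eq_bigr => j _.
by rewrite mxE.
Qed.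

Lemma det_row_eq0 (R : comNzRingType) (n : nat) (A : 'M[R]_n) (j : 'I_n) :
  (forall i, A j i = 0) -> \det A = 0.
Proof.
move=> A0; rewrite (expand_det_row A j) big1 // => i _.
by rewrite A0 mul0r.
Qed.

(** Pigeonhole: no permutation sends the [k + 1] indices up to [k] into the [k] indices below [k],
    so every Leibniz term has a factor in the zero block. *)
Lemma det_block_eq0 (R : comNzRingType) (n : nat) (A : 'M[R]_n) (k : 'I_n) :
  (forall j i : 'I_n, (j <= k <= i)%N -> A j i = 0) -> \det A = 0.
Proof.
move=> A0; rewrite /determinant big1 // => s _.
suff [j lejk lesj] : exists2 j : 'I_n, (j <= k)%N & (k <= s j)%N.
  by rewrite (bigD1 j) //= A0 ?lejk // mul0r mulr0.
case: (pickP [pred j : 'I_n | (j <= k)%N && (k <= s j)%N]) => [j /andP[]|nos].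
  by exists j.
have sub : s @: [set j : 'I_n | (j <= k)%N] \subset [set j : 'I_n | (j < k)%N].
  apply/subsetP => _ /imsetP[j + ->]; rewrite !inE => lejk.
  by have := nos j; rewrite /= lejk /= leqNgt => /negbFE.
have := subset_leq_card sub; rewrite card_imset; last exact: perm_inj.
have -> : [set j : 'I_n | (j <= k)%N] = k |: [set j : 'I_n | (j < k)%N].
  by apply/setP => j; rewrite !inE leq_eqVlt.
by rewrite cardsU1 inE ltnn add1n ltnn.
Qed.

(** * Factorial Grothendieck determinants and their Pieri rule *)

Section FactorialDeterminant.

Variables (K : fieldType) (d : nat) (B : nat -> K).
Hypothesis B_neq0 : forall l, B l != 0.

Definition fpoly k : {poly K} := \prod_(l < k) (B l.+1 *: 'X - 1).

Lemma horner_fpoly k x : (fpoly k).[x] = \prod_(l < k) (B l.+1 * x - 1).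
Proof.
rewrite horner_prod; apply: eq_bigr => l _.
by rewrite hornerD hornerN hornerZ hornerX hornerC.
Qed.

Lemma horner_fpolyS k x : (fpoly k.+1).[x] = (fpoly k).[x] * (B k.+1 * x - 1).
Proof. by rewrite !horner_fpoly big_ord_recr. Qed.

Lemma horner_fpoly_eq0 k m : (0 < m <= k)%N -> (fpoly k).[(B m)^-1] = 0.
Proof.
case: m => // m ltmk; rewrite horner_fpoly (bigD1 (Ordinal ltmk)) //=.
by rewrite divff // subrr mul0r.
Qed.

Lemma size_fpoly k : (size (fpoly k) <= k.+1)%N.
Proof.
rewrite /fpoly; elim: k => [|k IHk]; first by rewrite big_ord0 size_poly1.
rewrite big_ord_recr /= (leq_trans (size_polyMleq _ _)) //.
have : (size (B k.+1 *: 'X - 1 : {poly K})%R <= 2)%N.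
  rewrite (leq_trans (size_polyD _ _)) // geq_max size_polyN size_poly1 andbT.
  by rewrite (leq_trans (size_scale_leq _ _)) // size_polyX.
move=> size2; rewrite -subn1 leq_subLR (leq_trans (leq_add IHk size2)) //.
by rewrite addnC.
Qed.

Definition shifted (mu : {ffun 'I_d -> nat}) (j : 'I_d) : nat := (mu j + (d - j.+1))%N.

Definition gpoly (mu : {ffun 'I_d -> nat}) (j : 'I_d) : {poly K} :=
  fpoly (shifted mu j) * 'X^j.

(* The numerator of the bialternant formula for the factorial Grothendieck
   polynomial of [mu]. *)
Definition gdet (mu : {ffun 'I_d -> nat}) (x : 'I_d -> K) : K :=
  \det (\matrix_(j, i) (gpoly mu j).[x i]).

(** Comparing with every row above, not only the previous one, avoids predecessors in ['I_d]; for
    antitone [mu] the two agree, and row 0 is always addable. *)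
Definition addable (mu : {ffun 'I_d -> nat}) : {set 'I_d} :=
  [set i : 'I_d | [forall k : 'I_d, (k < i)%N ==> (mu i < mu k)%N]].

Definition grow (mu : {ffun 'I_d -> nat}) (S : {set 'I_d}) : {ffun 'I_d -> nat} :=
  [ffun i => (mu i + (i \in S))%N].

Definition antitone (mu : {ffun 'I_d -> nat}) : Prop :=
  forall i j : 'I_d, (i <= j)%N -> (mu j <= mu i)%N.

Lemma gpolyE mu j x : (gpoly mu j).[x] = (fpoly (shifted mu j)).[x] * x ^+ j.
Proof. by rewrite /gpoly hornerM hornerXn. Qed.

Lemma gpoly_grow mu S j x : (gpoly (grow mu S) j).[x] =
  if j \in S then (fpoly (shifted mu j).+1).[x] * x ^+ j else (gpoly mu j).[x].
Proof.
by rewrite !gpolyE /shifted ffunE; case: (j \in S); rewrite ?addn0 ?addn1 ?addSn.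
Qed.

(** Some [k < j] has [mu k <= mu j], so [mu] is constant from row [k] to row [j]; row [j - 1] is the
    witness. *)
Lemma nonaddableP mu (j : 'I_d) : antitone mu -> j \notin addable mu ->
  exists2 k : 'I_d, j = k.+1 :> nat & mu k = mu j.
Proof.
move=> mu_anti; rewrite inE negb_forall => /existsP[k].
rewrite negb_imply -leqNgt => /andP[ltkj lemu].
have ltjd : (j.-1 < d)%N by have := ltn_ord j; lia.
exists (Ordinal ltjd) => /=; first by lia.
have := mu_anti (Ordinal ltjd) j; have := mu_anti k (Ordinal ltjd).
by move=> /=; lia.
Qed.

(* When [j] is not addable, row [j - 1] of the rescaled matrix is proportional
   to the part of row [j] coming from [grow], which row reduction removes. *)
Lemma gdet_pieri mu x : antitone mu ->
  \prod_i (x i * B (shifted mu i).+1) * gdet mu x =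
  \sum_(S : {set 'I_d} | S \subset addable mu) gdet (grow mu S) x.
Proof.
move=> mu_anti.
pose b i := B (shifted mu i).+1.
pose M := \matrix_(j, i) (b j * (gpoly mu j).[x i] * x i).
have detM : \det M = \prod_i (x i * b i) * gdet mu x.
  have -> : M = diag_mx (\row_j b j) *m
      (\matrix_(j, i) (gpoly mu j).[x i]) *m diag_mx (\row_j x j).
    by apply/matrixP => j i; rewrite mul_diag_mx mul_mx_diag !mxE.
  rewrite !det_mulmx !det_diag big_split /= mulrC mulrA; congr (_ * _ * _).
    by apply: eq_bigr => i _; rewrite mxE.
  by apply: eq_bigr => i _; rewrite mxE.
pose L := \matrix_(j < d, k < d)
  ((j == k)%:R - (if (j == k.+1 :> nat) && (j \notin addable mu)
                  then (b k)^-1 else 0) : K).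
have detL : \det L = 1.
  rewrite det_trig.
    by rewrite big1 // => j _; rewrite mxE eqxx ltn_eqF // subr0.
  apply/is_trig_mxP => j k ltjk; rewrite mxE.
  have -> : (j == k) = false by apply/eqP => e; move: ltjk; rewrite e ltnn.
  by rewrite (_ : (j == k.+1 :> nat) = false) ?subr0 //=; apply/eqP; lia.
rewrite -[LHS]/(\prod_i (x i * b i) * _) -detM -[LHS]mul1r -detL -det_mulmx.
have -> : L *m M = \matrix_(j, i)
    ((if j \in addable mu then (fpoly (shifted mu j).+1).[x i] * x i ^+ j else 0)
     + (gpoly mu j).[x i]).
  apply/matrixP => j i; rewrite !mxE.
  under eq_bigr do rewrite !mxE mulrBl.
  rewrite sumrB (bigD1 j) //= eqxx mul1r [X in _ + X - _]big1 ?addr0; last first.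
    by move=> k /negbTE nkj; rewrite eq_sym nkj mul0r.
  (* Here [b x = (b x - 1) + 1]: the first summand lengthens the row by one box, the second leaves
     it unchanged. *)
  have Mji : b j * (gpoly mu j).[x i] * x i =
      (fpoly (shifted mu j).+1).[x i] * x i ^+ j + (gpoly mu j).[x i].
    by rewrite gpolyE horner_fpolyS /b; ring.
  have [aj|naj] := boolP (j \in addable mu).
    by rewrite big1 ?subr0 // => k _; rewrite andbF mul0r.
  have [k0 jk0 muk0] := nonaddableP mu_anti naj.
  rewrite (bigD1 k0) //= jk0 eqxx /= [X in _ - (_ + X)]big1 ?addr0; last first.
    move=> k nk; rewrite (_ : (k0.+1 == k.+1) = false) ?mul0r //.
    by apply/negbTE; rewrite eqSS; apply: contraNneq nk => e; apply/eqP/val_inj.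
  rewrite Mji gpolyE [in X in _ - X]gpolyE.
  have -> : shifted mu k0 = (shifted mu j).+1.
    by rewrite /shifted muk0 jk0; have := ltn_ord j; lia.
  rewrite !mulrA mulVf ?B_neq0 // mul1r jk0 exprSr.
  by rewrite mulrA; ring.
rewrite det_rowD (bigID (fun S : {set 'I_d} => S \subset addable mu)) /= [X in _ + X]big1 ?addr0.
  apply: eq_bigr => S /subsetP subS; congr (\det _); apply/matrixP => j i.
  by rewrite !mxE gpoly_grow; case: ifP => // /subS ->.
(* The reduction has replaced the grown part of each nonaddable row by 0, so the remaining [S]
   select a zero row. *)
move=> S /subsetPn[j jS nj]; apply: (det_row_eq0 (j := j)) => i.
by rewrite mxE jS (negbTE nj).
Qed.

(** * Evaluation at the point attached to [lam] *)

Section Localization.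

Variable lam : {ffun 'I_d -> nat}.
Hypothesis lam_anti : antitone lam.

(** Inverting [B] one step past the shifted part gives a root of [fpoly m] for every
    [m > shifted lam i]. *)
Definition xpt (i : 'I_d) : K := (B (shifted lam i).+1)^-1.

(** If [lam k < mu k], then [lam i <= lam k < mu k <= mu j] whenever [j <= k <= i], so in that block
    every [fpoly] is evaluated at one of its roots. *)
Lemma gdet_vanish mu : antitone mu -> ~~ [forall i, (mu i <= lam i)%N] ->
  gdet mu xpt = 0.
Proof.
move=> mu_anti; rewrite negb_forall => /existsP[k]; rewrite -ltnNge => ltk.
apply: (det_block_eq0 (k := k)) => j i /andP[lejk leki].
rewrite mxE gpolyE horner_fpoly_eq0 ?mul0r //=.
have := mu_anti _ _ lejk; have := lam_anti leki; rewrite /shifted.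
by have := ltn_ord i; lia.
Qed.

(** For [j < i] the shifted part of row [j] exceeds that of row [i], so the same vanishing makes the
    matrix lower triangular. *)
Lemma gdet_diag : gdet lam xpt = \prod_i (gpoly lam i).[xpt i].
Proof.
rewrite /gdet det_trig; first by apply: eq_bigr => i _; rewrite mxE.
apply/is_trig_mxP => j i ltji; rewrite mxE gpolyE horner_fpoly_eq0 ?mul0r //=.
have := lam_anti (ltnW ltji); rewrite /shifted.
by have := ltn_ord i; lia.
Qed.

End Localization.

(** For empty [mu] row [j] is a polynomial of degree less than [d] divisible by [X^j], so the matrix
    is a triangular coefficient matrix times a Vandermonde matrix. The diagonal coefficients
    [(-1)^(d - 1 - j)] absorb the signs turning [x j - x i] into [x i - x j]. *)
Lemma gdet0 x : gdet [ffun=> 0%N] x = \prod_(i < d) \prod_(j < d | (i < j)%N) (x i - x j).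
Proof.
pose C : 'M[K]_d := \matrix_(j, k) (gpoly [ffun=> 0%N] j)`_k.
rewrite /gdet (_ : \matrix_(_, _) _ = C *m Vandermonde d (\row_i x i)); last first.
  apply/matrixP => j i; rewrite !mxE (horner_coef_wide (n := d)).
    by apply: eq_bigr => k _; rewrite !mxE.
  rewrite (leq_trans (size_polyMleq _ _)) // size_polyXn.
  have := size_fpoly (shifted [ffun=> 0%N] j); rewrite /shifted ffunE.
  by have := ltn_ord j; lia.
rewrite det_mulmx det_Vandermonde -(det_tr C) det_trig; last first.
  apply/is_trig_mxP => k j ltkj; rewrite !mxE /gpoly coefMXn.
  by rewrite ltkj.
rewrite -big_split /=; apply: eq_bigr => i _.
rewrite !mxE /gpoly coefMXn ltnn subnn -horner_coef0 horner_fpoly.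
rewrite (eq_bigr (fun=> -1)); last by move=> l _; rewrite mulr0 sub0r.
rewrite prodr_const card_ord /shifted ffunE add0n.
rewrite (eq_bigr (fun j => - (x i - x j))); last by move=> j _; rewrite !mxE opprB.
rewrite prodrN mulrA.
have -> : #|[pred j : 'I_d | (i < j)%N]| = (d - i.+1)%N.
  by rewrite -sum1_card -(big_geq_mkord _ _ xpredT (fun=> 1%N)) sum_nat_const_nat muln1.
by rewrite -exprD addnn -mul2n exprM sqrrN expr1n expr1n mul1r.
Qed.

End FactorialDeterminant.

(** * Skew increasing tableaux *)

Section SkewTableaux.

Variables d n : nat.
Local Notation shape := {ffun 'I_d -> nat}.
Local Notation filling := {ffun 'I_d * 'I_n -> nat}.
Implicit Types (lam mu : shape) (f g : filling) (S : {set 'I_d}).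
Local Open Scope nat_scope.

(* The value 0 marks the cells outside [lam / mu], those of [mu] included, so
   that [shrink] below makes the cells with entry 1 part of [mu]. *)
Definition in_skew lam mu (c : 'I_d * 'I_n) : bool := mu c.1 <= c.2 < lam c.1.

Definition fmax f : nat := \max_c f c.

Definition skew_sit lam mu f : bool :=
  [&& [forall i : 'I_d, forall j : 'I_n, in_skew lam mu (i, j) == (0 < f (i, j))],
      [forall i : 'I_d, forall j1 : 'I_n, forall j2 : 'I_n,
         ((j1 < j2) && (0 < f (i, j2))) ==> (f (i, j1) < f (i, j2))],
      [forall i1 : 'I_d, forall i2 : 'I_d, forall j : 'I_n,
         ((i1 < i2) && (0 < f (i2, j))) ==> (f (i1, j) < f (i2, j))] &
      [forall k : 'I_(fmax f).+1, (0 < k) ==> [exists c, f c == k]]].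

Definition ones f : {set 'I_d} := [set i | [exists j, f (i, j) == 1]].

Definition shrink f : filling := [ffun c => (f c).-1].

Definition raise lam mu f : filling := [ffun c => f c + in_skew lam mu c].

(** In a skew tableau the cells of [mu] have value 0 and so count for every [k > 0]; the test
    [j < lam i] excludes the zeros outside [lam]. *)
Definition below lam f k : shape :=
  [ffun i => #|[set j : 'I_n | (j < lam i) && (f (i, j) < k)]|].

Lemma skew_sitP lam mu f : reflect
  [/\ forall i j, in_skew lam mu (i, j) = (0 < f (i, j)),
      forall i (j1 j2 : 'I_n), j1 < j2 -> 0 < f (i, j2) -> f (i, j1) < f (i, j2),
      forall (i1 i2 : 'I_d) j, i1 < i2 -> 0 < f (i2, j) -> f (i1, j) < f (i2, j) &
      forall k, 0 < k <= fmax f -> exists c, f c = k]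
  (skew_sit lam mu f).
Proof.
apply: (iffP and4P) => -[H1 H2 H3 H4].
  split.
  - by move=> i j; move/forallP/(_ i)/forallP/(_ j)/eqP: H1.
  - move=> i j1 j2 lt12 f0.
    by move/forallP/(_ i)/forallP/(_ j1)/forallP/(_ j2): H2; rewrite lt12 f0.
  - move=> i1 i2 j lt12 f0.
    by move/forallP/(_ i1)/forallP/(_ i2)/forallP/(_ j): H3; rewrite lt12 f0.
  - move=> k /andP[k0 lek].
    move/forallP/(_ (Ordinal (lek : k < (fmax f).+1))): H4.
    by rewrite k0 => /existsP[c /eqP]; exists c.
split.
- by apply/forallP => i; apply/forallP => j; rewrite H1.
- apply/forallP => i; apply/forallP => j1; apply/forallP => j2.
  by apply/implyP => /andP[]; apply: H2.
- apply/forallP => i1; apply/forallP => i2; apply/forallP => j.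
  by apply/implyP => /andP[]; apply: H3.
- apply/forallP => k; apply/implyP => k0.
  have [|c /eqP fc] := H4 k; first by rewrite k0 -ltnS ltn_ord.
  by apply/existsP; exists c.
Qed.

Lemma leq_fmax f c : f c <= fmax f.
Proof. exact: leq_bigmax. Qed.

Lemma fmax_shrink f : fmax (shrink f) = (fmax f).-1.
Proof.
apply/eqP; rewrite eqn_leq; apply/andP; split.
  by apply/bigmax_leqP => c _; rewrite ffunE; have := leq_fmax f c; lia.
suff : fmax f <= (fmax (shrink f)).+1 by lia.
apply/bigmax_leqP => c _; have := leq_fmax (shrink f) c.
by rewrite ffunE; lia.
Qed.

(** * Removing and restoring the entries equal to 1 *)

Section Step.

Variables lam mu : shape.
Hypotheses (lam_anti : antitone lam) (mu_anti : antitone mu).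
Hypothesis le_mu_lam : forall i, mu i <= lam i.
Hypothesis le_lam_n : forall i, lam i <= n.

(** Were the 1 further right, the cell [(i, mu i)] would hold a positive entry smaller than 1. *)
Lemma one_cell f i j : skew_sit lam mu f -> f (i, j) = 1 -> mu i = j.
Proof.
case/skew_sitP=> cells rows _ _ f1; have := cells i j; rewrite f1 /in_skew /=.
case/andP=> le_mu lt_lam; apply/eqP; rewrite eqn_leq le_mu /= leqNgt.
apply/negP => lt_mu; have lt_n : mu i < n by have := ltn_ord j; lia.
have := rows i (Ordinal lt_n) j lt_mu; rewrite f1 => /(_ isT).
have := cells i (Ordinal lt_n); rewrite /in_skew /= leqnn /=.
by move: lt_mu lt_lam; lia.
Qed.

Lemma onesP f i : skew_sit lam mu f ->
  reflect (exists2 j : 'I_n, mu i = j & f (i, j) = 1) (i \in ones f).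
Proof.
move=> sf; rewrite inE; apply: (iffP existsP) => [[j /eqP f1]|[j _ /eqP f1]].
  by exists j => //; apply: one_cell f1.
by exists j.
Qed.

(** Otherwise some cell above a 1 would lie in [lam / mu], and its positive entry would have to be
    smaller than 1. *)
Lemma ones_addable f : skew_sit lam mu f -> ones f \subset addable mu.
Proof.
move=> sf; apply/subsetP => i /(onesP i sf)[j mui f1]; rewrite inE.
apply/forallP => k; apply/implyP => ltki; rewrite mui ltnNge; apply/negP => lekj.
case/skew_sitP: sf => cells _ cols _.
have := cols k i j ltki; rewrite f1 => /(_ isT).
have := cells i j; have := cells k j; rewrite /in_skew /= lekj f1 /=.
by have := lam_anti (ltnW ltki); lia.
Qed.

Lemma grow_ones_le f i : skew_sit lam mu f -> grow mu (ones f) i <= lam i.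
Proof.
move=> sf; rewrite ffunE; case: (onesP i sf) => [[j mui f1]|_]; last first.
  by rewrite addn0.
case/skew_sitP: sf => cells _ _ _.
by have := cells i j; rewrite f1 /in_skew /= mui; lia.
Qed.

Lemma skew_sit_shrink f :
  skew_sit lam mu f -> skew_sit lam (grow mu (ones f)) (shrink f).
Proof.
move=> sf; have := sf; case/skew_sitP => cells rows cols surj; apply/skew_sitP; split.
- move=> i j; rewrite /in_skew /= !ffunE.
  have := cells i j; rewrite /in_skew /=.
  case: (onesP i sf) => [[j1 mui f1]|no1].
    have [->|nj] := eqVneq j j1; first by rewrite f1 mui; lia.
    have : f (i, j) != 1.
      apply: contraNneq nj => /(one_cell sf) e.
      by apply/eqP/val_inj; rewrite /= -e.
    by move: nj; rewrite -val_eqE /= mui; lia.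
  have : f (i, j) != 1.
    by apply/eqP => f1; apply: no1; exists j => //; apply: one_cell f1.
  by lia.
- by move=> i j1 j2 /(rows i); rewrite !ffunE; lia.
- by move=> i1 i2 j /cols - /(_ j); rewrite !ffunE; lia.
- move=> k; rewrite fmax_shrink => lek.
  have [|c fc] := surj k.+1; first by lia.
  by exists c; rewrite ffunE fc.
Qed.

Lemma raise_shrink f : skew_sit lam mu f -> raise lam mu (shrink f) = f.
Proof.
case/skew_sitP=> cells _ _ _; apply/ffunP => -[i j].
by rewrite !ffunE cells; case: (f (i, j)) => [|m] //=; rewrite addn1.
Qed.

Lemma ones_neq0 f : skew_sit lam mu f -> 0 < fmax f -> ones f != set0.
Proof.
case/skew_sitP=> _ _ _ surj f0; have [|[i j] fc] := surj 1; first by rewrite f0.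
by apply/set0Pn; exists i; rewrite inE; apply/existsP; exists j; rewrite fc.
Qed.

Lemma fmax_gt0 f : skew_sit lam mu f -> mu != lam -> 0 < fmax f.
Proof.
case/skew_sitP=> cells _ _ _ neq.
have [i lti] : exists i, mu i < lam i.
  apply/existsP; apply: contraNT neq; rewrite negb_exists => /forallP H.
  apply/eqP/ffunP => i; apply/eqP.
  by rewrite eqn_leq le_mu_lam leqNgt (H i).
have ltn : mu i < n by apply: leq_trans lti _.
have := leq_fmax f (i, Ordinal ltn).
by have := cells i (Ordinal ltn); rewrite /in_skew /=; lia.
Qed.

Section Raise.

Variables (S : {set 'I_d}) (g : filling).
Hypothesis sg : skew_sit lam (grow mu S) g.

Lemma shrink_raise : shrink (raise lam mu g) = g.
Proof.
case/skew_sitP: sg => cells _ _ _; apply/ffunP => -[i j].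
rewrite !ffunE; have := cells i j; rewrite /in_skew /= ffunE.
by lia.
Qed.

Hypothesis le_grow : forall i, grow mu S i <= lam i.

Lemma raise_eq1 i j : (raise lam mu g (i, j) == 1) = (i \in S) && (mu i == j).
Proof.
case/skew_sitP: sg => cells _ _ _.
have := cells i j; have := le_grow i; rewrite /in_skew /= !ffunE /in_skew /=.
by case: (i \in S); lia.
Qed.

Lemma ones_raise : ones (raise lam mu g) = S.
Proof.
apply/setP => i; rewrite inE; apply/existsP/idP => [[j]|iS].
  by rewrite raise_eq1 => /andP[].
have lt_n : mu i < n.
  by have := le_grow i; have := le_lam_n i; rewrite ffunE iS; lia.
by exists (Ordinal lt_n); rewrite raise_eq1 iS /=.
Qed.

Hypotheses (S_neq0 : S != set0) (S_add : S \subset addable mu).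

(** A new 1 has only cells of [mu] to its left and, by [S_add], above it; [S_neq0] supplies the
    entry 1 that surjectivity demands. *)
Lemma skew_sit_raise : skew_sit lam mu (raise lam mu g).
Proof.
have := sg; case/skew_sitP => cells rows cols surj.
have gE i j : (0 < raise lam mu g (i, j)) = in_skew lam mu (i, j).
  by rewrite ffunE; have := cells i j; rewrite /in_skew /= ffunE; lia.
(* A cell of [lam / mu] where [g] is 0 lies in [grow mu S] but not in [mu], hence is one of the new
   corners. *)
have low i j : 0 < raise lam mu g (i, j) -> g (i, j) = 0 -> (i \in S) && (mu i == j).
  move=> r0 g0; rewrite -raise_eq1; move: r0.
  by rewrite ffunE g0; case: (in_skew _ _ _).
apply/skew_sitP; split.
- by move=> i j; rewrite gE.
- move=> i j1 j2 lt12 r0; have [g0|g0] := posnP (g (i, j2)).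
    have /andP[_ /eqP muj] := low i j2 r0 g0.
    apply: leq_ltn_trans r0; rewrite leqNgt gE /in_skew /= muj.
    by move: lt12; lia.
  have := rows i j1 j2 lt12 g0; move: r0; rewrite gE !ffunE => ->.
  by case: (in_skew _ _ _); lia.
- move=> i1 i2 j lt12 r0; have [g0|g0] := posnP (g (i2, j)).
    have /andP[i2S /eqP muj] := low i2 j r0 g0.
    apply: leq_ltn_trans r0; rewrite leqNgt gE /in_skew /= -muj.
    move/subsetP/(_ i2 i2S): S_add; rewrite inE => /forallP/(_ i1).
    by rewrite lt12 /=; lia.
  have := cols i1 i2 j lt12 g0; move: r0; rewrite gE !ffunE => ->.
  by case: (in_skew _ _ _); lia.
- move=> [|[|k]] //.
    move=> _; have /set0Pn[i] := S_neq0; rewrite -ones_raise inE => /existsP[j /eqP].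
    by exists (i, j).
  have : fmax g = (fmax (raise lam mu g)).-1 by rewrite -fmax_shrink shrink_raise.
  move=> fE lek; have [|[i j] gc] := surj k.+1; first by lia.
  exists (i, j); rewrite ffunE gc (_ : in_skew _ _ _) ?addn1 //.
  by rewrite -gE ffunE gc.
Qed.

End Raise.

End Step.

Lemma below1 lam mu f : (forall i, mu i <= lam i) -> (forall i, lam i <= n) ->
  skew_sit lam mu f -> below lam f 1 = mu.
Proof.
move=> le_mu le_n /skew_sitP[cells _ _ _]; apply/ffunP => i; rewrite ffunE.
have le_mun : mu i <= n by apply: leq_trans (le_n i).
have -> : [set j : 'I_n | (j < lam i) && (f (i, j) < 1)] =
          [set widen_ord le_mun k | k : 'I_(mu i)].
  apply/setP => j; rewrite inE; have := cells i j; rewrite /in_skew /= => cE.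
  apply/idP/imsetP => [H|[k _ ->]] /=.
    have lt_mu : j < mu i by move: cE H; have := le_mu i; lia.
    by exists (Ordinal lt_mu) => //; apply: val_inj.
  have := cells i (widen_ord le_mun k); rewrite /in_skew /=.
  by have := ltn_ord k; have := le_mu i; lia.
rewrite card_imset ?card_ord // => k1 k2 /(congr1 val) /= e.
exact: val_inj.
Qed.

(** The offset keeps the right-hand bound positive: with bound 0 the zero cells would be counted on
    the left only. *)
Lemma belowSS lam f k : below lam f k.+2 = below lam (shrink f) k.+1.
Proof.
apply/ffunP => i; rewrite !ffunE; congr #|pred_of_set _|.
by apply/setP => j; rewrite !inE ffunE; lia.
Qed.

(** * Weighted sums over skew tableaux and their recursion *)

Section Weights.

Variables (K : fieldType) (w : shape -> K) (lam : shape).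
Hypothesis lam_anti : antitone lam.
Hypothesis le_lam_n : forall i, lam i <= n.

Definition weight f : K := (\prod_(1 <= k < (fmax f).+1) w (below lam f k))%R.

Lemma weight_step mu f : (forall i, mu i <= lam i) -> skew_sit lam mu f ->
  0 < fmax f -> weight f = (w mu * weight (shrink f))%R.
Proof.
move=> le_mu sf f0; rewrite /weight big_ltn // (below1 le_mu le_lam_n sf).
rewrite fmax_shrink prednK // big_add1 /=; congr (_ * _)%R.
by apply: eq_big_nat => -[|k] // _; rewrite belowSS.
Qed.

(** Forgets the bound [N] that makes the set of fillings finite, so that different bounds share one
    notion of tableau. *)
Definition natf N (T : {ffun 'I_d * 'I_n -> 'I_N.+1}) : filling :=
  [ffun c => (T c : nat)].

Definition ssum N mu : K :=
  (\sum_(T : {ffun 'I_d * 'I_n -> 'I_N.+1} | skew_sit lam mu (natf T)) weight (natf T))%R.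

Definition growing mu S : bool :=
  [&& S != set0, S \subset addable mu & [forall i, grow mu S i <= lam i]].

(** The tableaux are sorted by the set [S] of rows containing a 1. For fixed [S], [shrink] is a
    bijection onto the tableaux of shape [lam / grow mu S], with inverse [raise]; it lowers the
    bound by one and extracts the factor [w mu]. *)
Lemma ssumS N mu : antitone mu -> (forall i, mu i <= lam i) -> mu != lam ->
  ssum N.+1 mu = (w mu * \sum_(S | growing mu S) ssum N (grow mu S))%R.
Proof.
move=> mu_anti le_mu neq.
rewrite /ssum (partition_big (fun T => ones (natf T)) (growing mu)) /=; last first.
  move=> T sT; have f0 := fmax_gt0 le_mu le_lam_n sT neq.
  rewrite /growing (ones_neq0 sT f0) (ones_addable lam_anti sT).
  by apply/forallP => i; apply: grow_ones_le.
rewrite big_distrr; apply: eq_bigr => S /and3P[S0 Sadd /forallP Sle].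
rewrite big_distrr /=.
(* No value is lost in [inord]: raising adds at most 1, and shrinking an entry at most [N + 1]
   leaves at most [N]. *)
pose h (g : {ffun 'I_d * 'I_n -> 'I_N.+1}) : {ffun 'I_d * 'I_n -> 'I_N.+2} :=
  [ffun c => inord (raise lam mu (natf g) c)].
pose h' (T : {ffun 'I_d * 'I_n -> 'I_N.+2}) : {ffun 'I_d * 'I_n -> 'I_N.+1} :=
  [ffun c => inord (shrink (natf T) c)].
have hE T : natf (h T) = raise lam mu (natf T).
  apply/ffunP => c; rewrite !ffunE inordK //.
  by have := ltn_ord (T c); case: (in_skew _ _ _); lia.
have h'E T : natf (h' T) = shrink (natf T).
  apply/ffunP => c; rewrite !ffunE inordK //.
  by have := ltn_ord (T c); lia.
have natfI M : injective (@natf M).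
  move=> T1 T2 /ffunP e; apply/ffunP => c; apply: val_inj.
  by have := e c; rewrite !ffunE.
rewrite (reindex_onto h h') /=; last first.
  by move=> T /andP[sT _]; apply: natfI; rewrite hE h'E (raise_shrink sT).
have shr T : skew_sit lam mu (natf T) -> ones (natf T) = S ->
    skew_sit lam (grow mu S) (shrink (natf T)).
  by move=> sT <-; apply: skew_sit_shrink.
apply: eq_big => [g|g /andP[/andP[sT _] /eqP hh]]; last first.
  rewrite (weight_step le_mu sT) ?(fmax_gt0 le_mu le_lam_n sT neq) //.
  by rewrite -h'E hh.
apply/idP/idP => [/andP[/andP[sT /eqP oT] /eqP hh]|sg].
  by rewrite -hh h'E shr.
rewrite hE (skew_sit_raise le_lam_n sg Sle S0 Sadd) (ones_raise le_lam_n sg Sle) eqxx /=.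
by apply/eqP/natfI; rewrite h'E hE (shrink_raise sg).
Qed.

(** A row of [S] is strictly shorter than all rows above it, so one more box keeps the order. *)
Lemma grow_antitone mu S : antitone mu -> S \subset addable mu -> antitone (grow mu S).
Proof.
move=> mu_anti /subsetP Sadd i j leij; rewrite !ffunE.
have [jS|_] := boolP (j \in S); last by have := mu_anti i j leij; lia.
have [->|neq] := eqVneq i j; first by rewrite jS.
have ltij : i < j by rewrite ltn_neqAle neq.
by have := Sadd j jS; rewrite inE => /forallP/(_ i); rewrite ltij /=; lia.
Qed.

Lemma ssum_self N : ssum N lam = 1%R.
Proof.
have fmax0 f : skew_sit lam lam f -> f = [ffun=> 0].
  case/skew_sitP=> cells _ _ _; apply/ffunP => -[i j].
  by have := cells i j; rewrite /in_skew ffunE /=; lia.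
have fm0 : fmax [ffun=> 0] = 0.
  by rewrite /fmax big1 // => c _; rewrite ffunE.
have nat0 : natf ([ffun=> ord0] : {ffun _ -> 'I_N.+1}) = [ffun=> 0].
  by apply/ffunP => c; rewrite !ffunE.
rewrite /ssum (big_pred1 [ffun=> ord0]); last first.
  move=> T; apply/idP/eqP => [/fmax0/ffunP e|->].
    by apply/ffunP => c; apply: val_inj; have := e c; rewrite !ffunE.
  rewrite nat0; apply/skew_sitP; split=> [i j||| k].
  - by rewrite /in_skew ffunE /=; lia.
  - by move=> i j1 j2; rewrite !ffunE.
  - by move=> i j1 j2; rewrite !ffunE.
  - by rewrite fm0; lia.
by rewrite nat0 /weight fm0 big_geq.
Qed.

(* The bound [N] on the entries of the tableaux decreases with each step,
   together with the size of [lam / mu]. *)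
Lemma ssum_unique (D : shape -> K) N mu :
  (forall nu, antitone nu -> (forall i, nu i <= lam i) -> nu != lam ->
     D nu = (w nu * \sum_(S | growing nu S) D (grow nu S))%R) ->
  antitone mu -> (forall i, mu i <= lam i) ->
  \sum_i (lam i - mu i) <= N -> (ssum N mu * D lam)%R = D mu.
Proof.
move=> rec; elim: N mu => [|N IHN] mu mu_anti le_mu.
  rewrite leqn0 sum_nat_eq0 => /forallP le_lam.
  suff -> : mu = lam by rewrite ssum_self mul1r.
  by apply/ffunP => i; have := le_lam i; have := le_mu i; rewrite /=; lia.
have [->|neq] := eqVneq mu lam; first by rewrite ssum_self mul1r.
move=> leN; rewrite ssumS // (rec mu) // -mulrA; congr (_ * _)%R.
rewrite big_distrl /=; apply: eq_bigr => S /and3P[/set0Pn[i iS] Sadd /forallP Sle].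
apply: IHN => //; first exact: grow_antitone.
rewrite -ltnS; apply: leq_trans leN.
rewrite [ltnRHS](bigD1 i) // [ltnLHS](bigD1 i) //= -addSn leq_add //.
  by have := Sle i; rewrite ffunE iS; lia.
by apply: leq_sum => j _; rewrite ffunE; lia.
Qed.

End Weights.

End SkewTableaux.

(** The Pieri term with [S] empty is the determinant of [mu] itself; moving it to the left turns [p]
    into [p - 1], and [gdet_vanish] removes the shapes that leave [lam]. *)
Lemma gdet_rec (K : fieldType) (d : nat) (B : nat -> K) (lam mu : {ffun 'I_d -> nat}) :
  (forall l, B l != 0) -> antitone lam -> antitone mu ->
  let p := \prod_i (xpt B lam i * B (shifted mu i).+1) in p != 1 ->
  gdet B mu (xpt B lam) =
    (p - 1)^-1 * \sum_(S | growing lam mu S) gdet B (grow mu S) (xpt B lam).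
Proof.
move=> B0 lam_anti mu_anti p p1.
have pN0 : p - 1 != 0 by rewrite subr_eq0.
apply: (mulfI pN0); rewrite mulVKf // mulrBl mul1r gdet_pieri //.
rewrite (bigD1 set0) ?sub0set //=.
have -> : grow mu set0 = mu by apply/ffunP => i; rewrite ffunE inE addn0.
rewrite [LHS]addrC addrA addNr add0r.
rewrite (bigID (fun S => [forall i, (grow mu S i <= lam i)%N])) /= [X in _ + X]big1 ?addr0.
  by apply: eq_bigl => S; rewrite /growing andbCA andbA.
move=> S /andP[/andP[Sadd _] Sle].
by apply: gdet_vanish => //; apply: grow_antitone.
Qed.

(** * Hooks *)

Section Partitions.

Local Open Scope nat_scope.

(** The adjunction between a partition and its conjugate: once a part is at most [j], so are all
    later ones. *)
Lemma part_gt lam k j : sorted geq lam -> (j < part lam k) = (k < conj_part lam j.+1).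
Proof.
rewrite /part /conj_part; elim: lam k => [|x s IHs] k; first by rewrite nth_nil.
move=> /= srt; have {}IHs := IHs _ (path_sorted srt).
have le_x : all (geq x) s by apply: order_path_min srt => a b c /=; lia.
have [ltjx|lexj] := ltnP j x; first by case: k => //= k; rewrite add1n ltnS IHs.
have c0 : count (fun y => j < y) s = 0.
  apply/eqP; rewrite -leqn0 leqNgt -has_count; apply/hasPn => y ys.
  by move/allP/(_ y ys): le_x => /=; lia.
by case: k => [|k] /=; rewrite add0n ?IHs c0 //; lia.
Qed.

Lemma conj_part_le lam j : conj_part lam j <= size lam.
Proof. exact: count_size. Qed.

Lemma part_anti lam k l : sorted geq lam -> k <= l -> part lam l <= part lam k.
Proof.
move=> srt lekl; have [->//|p0] := posnP (part lam l).
rewrite -(prednK p0) part_gt //; apply: leq_ltn_trans lekl _.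
by rewrite -part_gt // prednK.
Qed.

Variables (d : nat) (lam : seq nat).
Hypotheses (srt : sorted geq lam) (le_d : size lam <= d).

Definition content_shift (j : nat) : nat := d + j.+1 - conj_part lam j.+1.

(* By [hookE], [content_shift j] is [lam_i + d - i] minus the hook length of
   [(i, j)]: this is the usual complementation of the hooks of a row. *)
Lemma perm_row_hooks i : i < d ->
  perm_eq (iota 1 (part lam i + (d - i.+1)))
    ([seq part lam k + d - k | k <- iota i.+1 (d - i.+1)]
     ++ [seq content_shift j | j <- iota 0 (part lam i)]).
Proof.
move=> ltid.
have key k j : (j < part lam k) = (k < conj_part lam j.+1) by apply: part_gt.
have cle j : conj_part lam j <= d := leq_trans (conj_part_le lam j) le_d.
set s := _ ++ _.
have szs : size s = part lam i + (d - i.+1).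
  by rewrite size_cat !size_map !size_iota addnC.
have us : uniq s.
  rewrite cat_uniq !map_inj_in_uniq ?iota_uniq ?andbT /=.
  (* A common value would give [part lam k - (j + 1) = k - conj_part lam (j + 1)] over the integers;
     by [key] exactly one side is negative. *)
  - apply/hasPn => _ /mapP[j _ ->]; apply/mapP => -[k].
    rewrite mem_iota /content_shift => kd; have := key k j; have := cle j.+1.
    by case: (ltnP j (part lam k)); lia.
  - move=> j l _ _; rewrite /content_shift; have := cle j.+1; have := cle l.+1.
    have mono a b : a <= b -> conj_part lam b.+1 <= conj_part lam a.+1.
      by move=> leab; apply: sub_count => x /=; lia.
    by case: (ltngtP j l) => // ltjl; have := mono _ _ (ltnW ltjl); lia.
  - move=> k l; rewrite !mem_iota => kd ld.
    by case: (ltngtP k l) => // ltkl; have := part_anti srt (ltnW ltkl); lia.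
rewrite perm_sym; apply: (uniq_perm us (iota_uniq _ _)).
apply: (uniq_min_size us _ _).2 => [|]; last by rewrite szs size_iota.
move=> x; rewrite mem_cat mem_iota => /orP[] /mapP[y]; rewrite mem_iota => yd ->.
  by have := part_anti srt (_ : i <= y); lia.
by rewrite /content_shift; have := key i y; have := cle y.+1; lia.
Qed.

Lemma hookE i j : j < part lam i ->
  part lam i + d - i = content_shift j + hook lam i j.
Proof.
move=> ltj; rewrite /content_shift /hook.
have := leq_trans (conj_part_le lam j.+1) le_d.
by move: (ltj); rewrite part_gt //; lia.
Qed.

End Partitions.

Lemma prod_row_hooks (R : comNzRingType) (d : nat) (lam : seq nat) (i : 'I_d)
    (F : nat -> R) :
  sorted geq lam -> (size lam <= d)%N ->
  \prod_(l < part lam i + (d - i.+1)) F l.+1 =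
  (\prod_(k < d | (i < k)%N) F (part lam k + d - k)%N) *
  \prod_(j < part lam i) F (content_shift d lam j).
Proof.
move=> srt le_d.
have -> : \prod_(l < part lam i + (d - i.+1)) F l.+1 =
    \prod_(l <- iota 1 (part lam i + (d - i.+1))) F l.
  by rewrite -(big_mkord xpredT (fun l => F l.+1)) (iotaDl 1 0) big_map /index_iota subn0.
rewrite (perm_big _ (perm_row_hooks srt le_d (ltn_ord i))) big_cat !big_map /=.
congr (_ * _); first by rewrite (big_geq_mkord _ _ xpredT).
by rewrite -{1}[part lam i]subn0 big_mkord.
Qed.

(** * The quotient of the two determinants *)

Section Ratio.

Variables (K : fieldType) (d : nat) (B : nat -> K) (lam : seq nat).
Hypotheses (B_neq0 : forall l, B l != 0) (B_inj : injective B).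
Hypotheses (srt : sorted geq lam) (le_d : (size lam <= d)%N).

Let sh : {ffun 'I_d -> nat} := [ffun i : 'I_d => part lam i].
Let x := xpt B sh.

Let shE (i : 'I_d) : shifted sh i = (part lam i + (d - i.+1))%N.
Proof. by rewrite /shifted ffunE. Qed.

Let bE (i : 'I_d) : (shifted sh i).+1 = (part lam i + d - i)%N.
Proof. by rewrite /shifted ffunE; have := ltn_ord i; lia. Qed.

Let xE i : x i = (B (part lam i + d - i)%N)^-1.
Proof. by rewrite /x /xpt bE. Qed.

Let sh_anti : antitone sh.
Proof. by move=> i j leij; rewrite !ffunE part_anti. Qed.

Let row_factor (i : 'I_d) l := B l - B (part lam i + d - i)%N.

(** A zero factor would force [B] to agree at two different indices. *)
Lemma gdet_self_neq0 : gdet B sh x != 0.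
Proof.
rewrite gdet_diag //; apply/prodf_neq0 => i _; rewrite gpolyE mulf_neq0 //.
  rewrite horner_fpoly; apply/prodf_neq0 => l _.
  rewrite subr_eq0; apply: contraTneq isT => /(canRL (mulfK _)).
  rewrite invr_eq0 => /(_ (B_neq0 _)); rewrite invrK mul1r => /B_inj.
  by have := ltn_ord l; lia.
by rewrite expf_neq0 // invr_eq0.
Qed.

(** Both determinants are products over rows. In row [i], [prod_row_hooks] splits the diagonal entry
    of [gdet B sh x] into the Vandermonde factors for [k > i], which cancel, and the hook factors;
    the powers of [x i] leave the exponent [part lam i] of [B]. *)
Lemma gdet0_ratio :
  gdet B [ffun=> 0%N] x / gdet B sh x =
  (\prod_(i < d) B (part lam i + d - i)%N ^+ part lam i) *
  (\prod_(i < d) \prod_(j < part lam i)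
     (B (content_shift d lam j) - B (part lam i + d - i)%N))^-1.
Proof.
have x0 i : x i != 0 by rewrite xE invr_eq0.
set P := \prod_(i < d) _ ^+ _.
set Q := \prod_(i < d) \prod_(j < part lam i) row_factor i (content_shift d lam j).
have Q0 : Q != 0.
  apply/prodf_neq0 => i _; apply/prodf_neq0 => j _; rewrite subr_eq0.
  apply: contraTneq isT => /B_inj; rewrite (hookE srt le_d (ltn_ord j)) /hook; lia.
have P0 : P != 0 by apply/prodf_neq0 => i _; rewrite expf_neq0.
apply: (canLR (mulfK gdet_self_neq0)).
suff -> : gdet B sh x = gdet B [ffun=> 0%N] x * P^-1 * Q by field; rewrite P0.
have card_gt (i : 'I_d) : #|[pred k : 'I_d | (i < k)%N]| = (d - i.+1)%N.
  by rewrite -sum1_card -(big_geq_mkord _ _ xpredT (fun=> 1%N)) sum_nat_const_nat muln1.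
have card_lt (k : 'I_d) : #|[pred i : 'I_d | (i < k)%N]| = k.
  rewrite -sum1_card -(big_ord_widen _ (fun=> 1%N) (ltnW (ltn_ord k))).
  by rewrite sum1_card card_ord.
have lowE : \prod_(i < d) \prod_(k < d | (i < k)%N) x k = \prod_(k < d) x k ^+ k.
  rewrite (exchange_big_dep xpredT) //=; apply: eq_bigr => k _.
  by rewrite prodr_const card_lt.
(* Each [x i - x k] equals [x i * x k * row_factor i (part lam k + d - k)]; collecting powers by row
   gives these exponents. *)
have -> : gdet B [ffun=> 0%N] x = \prod_(i < d) (x i ^+ (d - i.+1) * x i ^+ i *
    \prod_(k < d | (i < k)%N) row_factor i (part lam k + d - k)%N).
  rewrite gdet0 !big_split /= -lowE -!big_split /=; apply: eq_bigr => i _.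
  rewrite -card_gt -prodr_const -!big_split /=; apply: eq_bigr => k _.
  by rewrite /row_factor !xE; field; rewrite !B_neq0.
rewrite gdet_diag // /P /Q -prodfV -!big_split /=.
apply: eq_bigr => i _; rewrite gpolyE horner_fpoly shE -/x.
rewrite (eq_bigr (fun l : 'I__ => x i * row_factor i l.+1)); last first.
  by move=> l _; rewrite /row_factor mulrBr xE mulVf // mulrC.
rewrite big_split /= prodr_const card_ord prod_row_hooks // exprD.
rewrite -exprVn -xE; ring.
Qed.

End Ratio.

(** * Rational functions in [beta] and [q] *)

Section Specialization.

Local Notation q := (('X : {poly rat})%:P).

(* Inequalities between rational functions are detected at [beta = 1], [q = 2]. *)
Definition eval12 (p : {poly {poly rat}}) : rat := p.[1].[2%:R].

Lemma tofrac_inj12 (p r : {poly {poly rat}}) :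
  FracField.tofrac p = FracField.tofrac r -> eval12 p = eval12 r.
Proof. by move/eqP; rewrite tofrac_eq => /eqP ->. Qed.

Lemma eval12_binomial a : eval12 (1 + 'X * q ^+ a) = 1 + 2%:R ^+ a.
Proof. by rewrite /eval12 -polyC_exp !hornerE. Qed.

Lemma tofrac_binomial a :
  FracField.tofrac (1 + 'X * q ^+ a) = 1 + betav * qv ^+ a.
Proof. by rewrite rmorphD rmorph1 rmorphM rmorphXn. Qed.

Lemma eval12_q a : eval12 (q ^+ a) = 2%:R ^+ a.
Proof. by rewrite /eval12 -polyC_exp !hornerE. Qed.

Lemma tofrac_q a : FracField.tofrac (q ^+ a) = qv ^+ a.
Proof. by rewrite rmorphXn. Qed.

Lemma betav_neq0 : betav != 0.
Proof.
apply/eqP => b0; have := @tofrac_inj12 'X 0.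
by rewrite rmorph0 /eval12 !hornerE => /(_ b0)/eqP; rewrite oner_eq0.
Qed.

Lemma qv_inj : injective (GRing.exp qv).
Proof.
move=> a b; rewrite -!tofrac_q => /tofrac_inj12; rewrite !eval12_q.
by apply: ieexprIn; rewrite ?ltr0n // gt_eqF // ltr1n.
Qed.

Lemma binomial_neq0 a : 1 + betav * qv ^+ a != 0.
Proof.
rewrite -tofrac_binomial; apply/eqP; rewrite -tofrac0.
move/tofrac_inj12; rewrite eval12_binomial /eval12 !horner0.
by apply/eqP; rewrite gt_eqF // addr_gt0 // exprn_gt0.
Qed.

Lemma binomial_inj : injective (fun a => 1 + betav * qv ^+ a).
Proof. by move=> a b /addrI/(mulfI betav_neq0)/qv_inj. Qed.

(** At [beta = 1], [q = 2] the factors become [1 + 2^a], positive and strictly increasing in [a], so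
    the two products are strictly ordered there. *)
Lemma prod_binomial_neq (d : nat) (a b : 'I_d -> nat) :
  (forall i, (a i <= b i)%N) -> (exists i, (a i < b i)%N) ->
  \prod_i (1 + betav * qv ^+ a i) != \prod_i (1 + betav * qv ^+ b i).
Proof.
move=> leab [i0 ltab]; apply/eqP.
under eq_bigr do rewrite -tofrac_binomial.
under [RHS]eq_bigr do rewrite -tofrac_binomial.
rewrite -!rmorph_prod => /tofrac_inj12.
have evalM (c : 'I_d -> nat) :
    eval12 (\prod_i (1 + 'X * q ^+ c i)) = \prod_i (1 + 2%:R ^+ c i).
  rewrite /eval12 !horner_prod; apply: eq_bigr => i _.
  exact: eval12_binomial.
rewrite !evalM; apply/eqP; rewrite lt_eqF //.
have pos n : (0 : rat) < 1 + 2%:R ^+ n by rewrite addr_gt0 // exprn_gt0.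
rewrite (bigD1 i0) // [ltRHS](bigD1 i0) //=.
apply: (@le_lt_trans _ _ ((1 + 2%:R ^+ a i0) * \prod_(i | i != i0) (1 + 2%:R ^+ b i))).
  rewrite ler_pM2l //; apply: ler_prod => i _.
  by rewrite ltW //= lerD2l ler_weXn2l // ler1n.
by rewrite ltr_pM2r ?prodr_gt0 // ltrD2l ltr_eXn2l // ltr1n.
Qed.

End Specialization.

(** * Standard increasing tableaux as skew tableaux with empty inner shape *)

Section Encoding.

Variables (d : nat) (lam : seq nat).
Let n := sumn lam.
Let sh : {ffun 'I_d -> nat} := [ffun i : 'I_d => part lam i].

Lemma mT_fmax (T : tableau d n) : mT T = fmax (natf T).
Proof. by apply: eq_bigr => c _; rewrite ffunE. Qed.

Lemma is_SIT_skew (T : tableau d n) :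
  is_SIT lam T = skew_sit sh [ffun=> 0%N] (natf T).
Proof.
have mE := esym (mT_fmax T).
have cE (i : 'I_d) (j : 'I_n) : in_skew sh [ffun=> 0%N] (i, j) = in_shape lam i j.
  by rewrite /in_skew !ffunE.
apply/idP/skew_sitP => [/and4P[H1 H2 H3 H4]|[H1 H2 H3 H4]].
  have cell (i : 'I_d) (j : 'I_n) : in_shape lam i j = (0 < T (i, j))%N.
    by move/forallP/(_ i)/forallP/(_ j)/eqP: H1.
  split=> [i j|i j1 j2 lt12|i1 i2 j lt12|k /andP[k0]].
  - by rewrite cE cell ffunE.
  - move/forallP/(_ i)/forallP/(_ j1)/forallP/(_ j2): H2.
    by rewrite !ffunE -cell lt12 /= => /implyP.
  - move/forallP/(_ i1)/forallP/(_ i2)/forallP/(_ j): H3.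
    by rewrite !ffunE -cell lt12 /= => /implyP.
  - rewrite mE => lek; have lekn : (k < n.+1)%N.
      by apply: leq_trans lek _; apply/bigmax_leqP => c _; rewrite -ltnS ltn_ord.
    move/forallP/(_ (Ordinal lekn)): H4; rewrite k0 lek /= => /existsP[c /eqP].
    by exists c; rewrite ffunE.
have cell (i : 'I_d) (j : 'I_n) : in_shape lam i j = (0 < T (i, j))%N by rewrite -cE H1 ffunE.
apply/and4P; split.
- by apply/forallP => i; apply/forallP => j; rewrite cell.
- apply/forallP => i; apply/forallP => j1; apply/forallP => j2.
  apply/implyP => /andP[lt12]; rewrite cell => T0.
  by have := H2 i j1 j2 lt12; rewrite !ffunE => /(_ T0).
- apply/forallP => i1; apply/forallP => i2; apply/forallP => j.
  apply/implyP => /andP[lt12]; rewrite cell => T0.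
  by have := H3 i1 i2 j lt12; rewrite !ffunE => /(_ T0).
- apply/forallP => k; apply/implyP; rewrite -mE => /H4[c].
  by rewrite ffunE => Tc; apply/existsP; exists c; rewrite Tc.
Qed.

Lemma nu_below (T : tableau d n) k i : nu lam T k i = below sh (natf T) k i.
Proof.
rewrite ffunE /nu; congr #|pred_of_set _|; apply/setP => j.
by rewrite !inE !ffunE.
Qed.

End Encoding.

Lemma sumn_part (lam : seq nat) (d : nat) : (size lam <= d)%N ->
  (\sum_(i < d) part lam i = sumn lam)%N.
Proof.
move=> le_d; rewrite sumnE (big_nth 0%N) big_mkord.
rewrite (big_ord_widen _ (fun i => nth 0%N lam i) le_d).
rewrite [LHS](bigID (fun i : 'I_d => (i < size lam)%N)) /=.
rewrite [X in (_ + X)%N]big1 ?addn0 // => i.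
by rewrite -leqNgt /part => /(nth_default _).
Qed.

Lemma part_le_sumn (lam : seq nat) k : (part lam k <= sumn lam)%N.
Proof.
rewrite /part; elim: lam k => [|a s IHs] [|k] //=; first exact: leq_addr.
by rewrite (leq_trans (IHs k)) // leq_addl.
Qed.

(** Since [conj_part] is at most [d], the truncated subtraction in [content_shift] is exact. *)
Lemma qexp_content (d : nat) (lam : seq nat) : (size lam <= d)%N ->
  qexp d lam = (\sum_(i < size lam) \sum_(j < part lam i) content_shift d lam j)%N.
Proof.
move=> le_d; rewrite /qexp -natz natr_sum; apply: eq_bigr => i _.
rewrite natr_sum; apply: eq_bigr => j _; rewrite /content_shift natz.
rewrite subzn //; exact: leq_trans (leq_trans (conj_part_le _ _) le_d) (leq_addr _ _).
Qed.

Theorem theorem4p7 (d : nat) (lam : seq nat) :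
  (1 <= d)%N -> is_partition lam -> (size lam <= d)%N ->
  \sum_(T : tableau d (sumn lam) | is_SIT lam T)
     \prod_(1 <= k < (mT T).+1)
       ((\prod_(i < d)
           ((1 + betav * qv ^+ (nu lam T k i + d - i)) /
            (1 + betav * qv ^+ (part lam i + d - i)))) - 1)^-1
  = qv ^ (- qexp d lam) / betav ^+ (sumn lam)
    * \prod_(i < d) (1 + betav * qv ^+ (part lam i + d - i)) ^+ (part lam i)
    * \prod_(i < size lam) \prod_(j < part lam i) (1 - qv ^+ (hook lam i j))^-1.
Proof.
move=> _ /andP[srt _] le_d.
set n := sumn lam.
pose B a : Kf := 1 + betav * qv ^+ a.
have B_neq0 a : B a != 0 := binomial_neq0 a.
pose sh : {ffun 'I_d -> nat} := [ffun i : 'I_d => part lam i].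
pose x := xpt B sh.
have sh_anti : antitone sh by move=> i j leij; rewrite !ffunE part_anti.
pose p (mu : {ffun 'I_d -> nat}) :=
  \prod_(i < d) (B (mu i + d - i)%N / B (part lam i + d - i)%N).
pose w mu := (p mu - 1)^-1.
have pE mu : p mu = \prod_i (x i * B (shifted mu i).+1).
  apply: eq_bigr => i _; rewrite mulrC /x /xpt /shifted ffunE.
  by congr ((B _)^-1 * B _); have := ltn_ord i; lia.
(* The inverse of 0 is 0 by convention, so the recursion needs each bracket to differ from 1; a
   proper subshape makes some exponent strictly smaller. *)
have p_neq1 (mu : {ffun 'I_d -> nat}) : (forall i, mu i <= sh i)%N -> mu != sh -> p mu != 1.
  move=> le_mu neq; rewrite /p prodf_div.
  have B0 : \prod_(i < d) B (part lam i + d - i)%N != 0 by apply/prodf_neq0.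
  rewrite -subr_eq0 -[X in _ - X](divff B0) -mulrBl mulf_neq0 ?invr_eq0 // subr_eq0.
  apply: prod_binomial_neq => [i|].
    by have := le_mu i; rewrite ffunE; lia.
  have [i lti] : exists i, (mu i < sh i)%N.
    apply/existsP; apply: contraNT neq; rewrite negb_exists => /forallP H.
    apply/eqP/ffunP => i; apply/eqP.
    by rewrite eqn_leq le_mu leqNgt (H i).
  by exists i; move: lti; rewrite ffunE; have := ltn_ord i; lia.
have rec mu : antitone mu -> (forall i, mu i <= sh i)%N -> mu != sh ->
    gdet B mu x = w mu * \sum_(S | growing sh mu S) gdet B (grow mu S) x.
  move=> mu_anti le_mu neq; rewrite /w pE; apply: gdet_rec => //.
  by rewrite -pE p_neq1.
have le_n i : (sh i <= n)%N by rewrite ffunE part_le_sumn.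
have le0 i : ([ffun=> 0%N] i <= sh i)%N by rewrite !ffunE.
have anti0 : antitone ([ffun=> 0%N] : {ffun 'I_d -> nat}) by move=> i j _; rewrite !ffunE.
(* The empty shape is [n] boxes away from [lam], so the bound [n] on the entries of a [tableau]
   loses nothing. *)
have size0 : (\sum_i (sh i - [ffun=> 0%N] i) <= n)%N.
  by under eq_bigr do rewrite !ffunE subn0; rewrite sumn_part.
have Dsh0 : gdet B sh x != 0 := gdet_self_neq0 B_neq0 binomial_inj srt le_d.
have main := ssum_unique sh_anti le_n rec anti0 le0 size0.
transitivity (ssum n w sh n [ffun=> 0%N]).
  apply: eq_big => [T|T _]; first exact: is_SIT_skew.
  rewrite /weight -mT_fmax; apply: eq_bigr => k _; rewrite /w /p.
  by congr (_ - 1)^-1; apply: eq_bigr => i _; rewrite nu_below.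
rewrite -[LHS](mulfK Dsh0) main (gdet0_ratio B_neq0 binomial_inj srt le_d).
rewrite [RHS]mulrAC [RHS]mulrC; congr (_ * _).
(* By [hookE] this is [B c - B (c + h)], with [c] the shifted content and [h] the hook length. *)
have factorE (i : 'I_d) (j : 'I_(part lam i)) :
    B (content_shift d lam j) - B (part lam i + d - i)%N =
    betav * qv ^+ content_shift d lam j * (1 - qv ^+ hook lam i j).
  by rewrite (hookE srt le_d (ltn_ord j)) /B exprD; ring.
under eq_bigr do rewrite (eq_bigr _ (fun j _ => factorE _ j)).
pose G i := \prod_(j < part lam i)
  (betav * qv ^+ content_shift d lam j * (1 - qv ^+ hook lam i j)).
rewrite -[LHS]/((\prod_(i < d) G i)^-1).
have -> : \prod_(i < d) G i = \prod_(i < size lam) G i.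
  rewrite (big_ord_widen _ G le_d) [RHS]big_mkcond; apply: eq_bigr => i _.
  case: ltnP => // /(nth_default 0%N) p0.
  by rewrite /G /part p0 big_ord0.
rewrite qexp_content // -invr_expz -exprnP.
rewrite /n -(sumn_part (leqnn (size lam))) -!prodrXr -!prodfV -!big_split /=.
apply: eq_bigr => i _; rewrite /G !big_split /= prodr_const card_ord -prodrXr prodfV !invfM.
by rewrite mulrC; ring.
Qed.
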